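(* Let $A$ be a commutative ring (not necessarily with unity), let $n$ be an integer with $1\le n\le 6$, and let $[\mathfrak{a}_1,\ldots,\mathfrak{a}_n]$ be a multiset of ideals of $A$. Then $$L(n)\,G(2)\,G(4)\cdots G(2\lfloor n/2\rfloor)\ \subset\ G(1)\,G(3)\cdots G(2\lceil n/2\rceil-1),$$ where the product $G(2)G(4)\cdots G(2\lfloor n/2\rfloor)$ runs over all even indices $k$ with $2\le k\le n$ and the product $G(1)G(3)\cdots G(2\lceil n/2\rceil-1)$ runs over all odd indices $k$ with $1\le k\le n$.
   Context: Rings are commutative and need not have a unity; a multiset is a finite list up to permutation, so repetitions $\mathfrak{a}_i=\mathfrak{a}_j$ with $i\ne j$ are allowed. The product of ideals is the usual one (the set of finite sums of products of elements). For ideals $\mathfrak{a}_1,\ldots,\mathfrak{a}_n$ of $A$ and $1\le k\le n$, put $$G(k)=\prod_{\{i_1,\ldots,i_k\}}(\mathfrak{a}_{i_1}+\cdots+\mathfrak{a}_{i_k}),\qquad L(k)=\prod_{\{i_1,\ldots,i_k\}}(\mathfrak{a}_{i_1}\cap\cdots\cap\mathfrak{a}_{i_k}),$$ where both products are over all subsets $\{i_1,\ldots,i_k\}$ of $\{1,\ldots,n\}$ with exactly $k$ distinct elements. In particular $L(n)=\mathfrak{a}_1\cap\cdots\cap\mathfrak{a}_n$ and $G(1)=\mathfrak{a}_1\cdots\mathfrak{a}_n$. An empty product of factors $G(k)$ (which occurs only for $n=1$) is simply omitted. The symbol $\subset$ means inclusion, equality allowed. *)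

(* Defs.v *)
From HB Require Import structures.
From mathcomp Require Import all_boot all_order all_algebra.
From mathcomp Require Import classical_sets.

Set Implicit Arguments.
Unset Strict Implicit.
Unset Printing Implicit Defensive.

Import GRing.Theory.
Local Open Scope classical_set_scope.
Local Open Scope ring_scope.

(* Commutative rings without a distinguished unity: every multiplicative
   structure of ssralg has a unity, so multiplication is added to zmodType. *)
HB.mixin Record Zmodule_isComRng A of GRing.Zmodule A := {
  rng_mul : A -> A -> A;
  rng_mulA : associative rng_mul;
  rng_mulC : commutative rng_mul;
  rng_mulDl : left_distributive rng_mul +%R
}.

#[short(type="comRngType")]
HB.structure Definition ComRng := { A of GRing.Zmodule A & Zmodule_isComRng A }.

Section IdealOperations.
Variable A : comRngType.

Definition is_ideal (I : set A) : Prop :=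
  [/\ I 0,
      forall x y, I x -> I y -> I (x - y)
    & forall x y, I y -> I (rng_mul x y)].

Definition ideal_mul (I J : set A) : set A :=
  [set z | exists2 s : seq (A * A),
     forall p, p \in s -> I p.1 /\ J p.2
   & z = \sum_(p <- s) rng_mul p.1 p.2].

(* Since A may have no unity, A itself need not be neutral for ideal_mul: a
   big operator with neutral element setT would multiply every product by an
   extra factor A.  So the product ends on its last factor, and the value
   setT is reached only for the empty list. *)
Fixpoint ideal_prod (s : seq (set A)) : set A :=
  match s with
  | [::] => [set: A]
  | [:: J] => J
  | J :: s' => ideal_mul J (ideal_prod s')
  end.

Section Family.
Variables (n : nat) (a : 'I_n -> set A).

Definition ideal_sum (T : {set 'I_n}) : set A :=
  [set x | exists2 f : 'I_n -> A,
     forall i, i \in T -> a i (f i) & x = \sum_(i in T) f i].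

Definition ideal_cap (T : {set 'I_n}) : set A :=
  [set x | forall i, i \in T -> a i x].

Definition idealG (k : nat) : set A :=
  ideal_prod [seq ideal_sum T | T : {set 'I_n} <- enum {set 'I_n} & #|T| == k].

Definition idealL (k : nat) : set A :=
  ideal_prod [seq ideal_cap T | T : {set 'I_n} <- enum {set 'I_n} & #|T| == k].

End Family.
End IdealOperations.

(* Main.v *)
Require Import Defs.
From HB Require Import structures.
From mathcomp Require Import all_boot all_order all_algebra.
From mathcomp Require Import classical_sets.
From mathcomp Require Import fintype finset zify.
Import GRing.Theory.

(** The inequality holds because the even subsets of {1, ..., n} can be matched
    with the odd ones in a way that respects any choice of elements.

    By distributivity, the left side is the sum, over all functions [c] choosing
    an element [c T] of every nonempty subset [T] of even size, of the products
    of [L(n)] with all the ideals [a (c T)] ([big_ideal_sum_sub]).  So it is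
    enough to put each of these products inside the right side, which is the
    product of the sums [a_U] of the [a i] with [i] in [U], over all subsets [U]
    of odd size.

    For a given [c] there is a bijection [phi] from even subsets to odd subsets
    such that [c T \in phi T] for every nonempty [T] ([even_odd_matching]).  Then
    the factor [a (c T)] is contained in the factor [a_(phi T)], and the factor
    [L(n)], which plays the part of the empty set, is contained in
    [a_(phi set0)], as [phi set0] has an element and [L(n)] lies in every [a i].

    The bijection comes from Hall's marriage theorem ([hall_marriage]).  Let [F]
    be a family of nonempty even sets and [S] the set of the chosen elements;
    the odd sets which the members of [F] may be matched with are those meeting
    [S].  Toggling a fixed element [j] outside [S] maps [F] injectively to such
    sets, since the chosen elements stay; if [S] contains every element, any [j]
    will do, since an odd set is nonempty.  If the empty set is in [F], all odd
    sets are available. *)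

(** * Hall's marriage theorem *)

Section Hall.
Context {X Y : finType}.
Implicit Types (N : X -> {set Y}) (D F : {set X}).

Definition nbhd N F : {set Y} := \bigcup_(x in F) N x.

(** Boolean, so that its failure can be turned into a violating family. *)
Definition hall_condition N D :=
  [forall F : {set X}, (F \subset D) ==> (#|F| <= #|nbhd N F|)].

Definition drop_edge N x0 y0 : X -> {set Y} :=
  fun x => if x == x0 then N x :\ y0 else N x.

Lemma sub_drop_edge N x0 y0 x : drop_edge N x0 y0 x \subset N x.
Proof. by rewrite /drop_edge; case: ifP => // _; apply: subD1set. Qed.

Lemma nbhdS N F1 F2 : F1 \subset F2 -> nbhd N F1 \subset nbhd N F2.
Proof. by move=> sF; apply/bigcupsP => x /(subsetP sF); apply: bigcup_sup. Qed.

Lemma nbhd_drop_edge N x0 y0 F :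
  x0 \notin F -> nbhd (drop_edge N x0 y0) F = nbhd N F.
Proof.
move=> x0F; apply: eq_bigr => x xF; rewrite /drop_edge.
by case: eqP xF x0F => // -> ->.
Qed.

(** Only the neighbourhoods of families containing [x0] are affected, so a new
    violation must involve [x0]. *)
Lemma drop_edge_deficit {N D x0 y0} :
    hall_condition N D -> ~~ hall_condition (drop_edge N x0 y0) D ->
  exists F, [/\ F \subset D, x0 \in F & #|nbhd (drop_edge N x0 y0) F| < #|F|].
Proof.
move=> /forallP hallN /forallPn [F].
rewrite negb_imply -ltnNge => /andP[FD ltF].
exists F; split=> //; apply: contraLR ltF => x0F.
by rewrite -leqNgt nbhd_drop_edge //; apply: implyP (hallN F) FD.
Qed.

(** If both deletions broke Hall's condition, on [F1] and on [F2] say, then the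
    two reduced neighbourhoods [P1] and [P2] would satisfy
    [#|P1| + #|P2| <= #|F1| + #|F2| - 2].  But [P1 :|: P2] recovers the
    neighbourhood of [F1 :|: F2], the two deleted edges being distinct, and
    [P1 :&: P2] contains that of [(F1 :&: F2) :\ x0]; Hall's condition for these
    two families bounds [#|P1| + #|P2|] below by [#|F1| + #|F2| - 1]. *)
Lemma hall_drop_edge N D x0 y1 y2 :
    hall_condition N D -> y1 != y2 ->
  hall_condition (drop_edge N x0 y1) D || hall_condition (drop_edge N x0 y2) D.
Proof.
move=> hallN y12; apply/norP => -[].
move=> /(drop_edge_deficit hallN) [F1 [F1D x0F1 lt1]].
move=> /(drop_edge_deficit hallN) [F2 [F2D x0F2 lt2]].
set P1 := nbhd _ F1 in lt1; set P2 := nbhd _ F2 in lt2.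
have leU : #|F1 :|: F2| <= #|P1 :|: P2|.
  apply: leq_trans (implyP (forallP hallN (F1 :|: F2)) _) _.
    by rewrite subUset F1D F2D.
  apply/subset_leq_card/subsetP => y /bigcupP[x xF yNx].
  have [xx0 | xx0] := eqVneq x x0; last first.
    case/setUP: xF => xF; apply/setUP; [left | right].
      by apply/bigcupP; exists x; rewrite // /drop_edge (negPf xx0).
    by apply/bigcupP; exists x; rewrite // /drop_edge (negPf xx0).
  rewrite {x}xx0 in xF yNx.
  have [yy1 | yy1] := eqVneq y y1; apply/setUP; [right | left].
    apply/bigcupP; exists x0; rewrite // /drop_edge eqxx.
    by rewrite !inE yy1 y12 -yy1.
  by apply/bigcupP; exists x0; rewrite // /drop_edge eqxx !inE yy1.
have leI : #|(F1 :&: F2) :\ x0| <= #|P1 :&: P2|.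
  apply: leq_trans (implyP (forallP hallN _) _) _.
    apply: subset_trans (subD1set _ _) _.
    by apply: subset_trans F1D; apply: subsetIl.
  have x0I : x0 \notin (F1 :&: F2) :\ x0 by rewrite setD11.
  apply: subset_leq_card; rewrite subsetI.
  apply/andP; split; [rewrite -(nbhd_drop_edge N x0 y1 _ x0I)
                     |rewrite -(nbhd_drop_edge N x0 y2 _ x0I)];
    apply: nbhdS; apply: subset_trans (subD1set _ _) _.
    exact: subsetIl.
  exact: subsetIr.
have := cardsUI F1 F2; have := cardsUI P1 P2.
have := cardsD1 x0 (F1 :&: F2); rewrite inE x0F1 x0F2 /=.
lia.
Qed.

(** Rado's proof: edges at a vertex of degree at least two can be deleted until
    every vertex of [D] has exactly one neighbour; two vertices cannot then share
    it, by Hall's condition for the pair. *)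
Lemma hall_marriage N D (y0 : Y) :
    hall_condition N D ->
  exists f : X -> Y, {in D &, injective f} /\ {in D, forall x, f x \in N x}.
Proof.
have [m] := ubnP (\sum_(x in D) #|N x|).
elim: m N => // m IHm N ltm hallN.
have [/exists_inP[x xD /card_gt1P[y1 [y2 [y1N y2N y12]]]] | ] :=
    boolP [exists x in D, 1 < #|N x|]; last first.
  rewrite negb_exists_in => /forall_inP N_le1.
  pose f x := odflt y0 [pick y in N x].
  have fN : {in D, forall x, N x = [set f x]}.
    move=> x xD; have := implyP (forallP hallN [set x]).
    rewrite sub1set xD cards1 /nbhd big_set1 => /(_ isT) N_ge1.
    have /cards1P[y Ny] : #|N x| == 1.
      by rewrite eqn_leq N_ge1 leqNgt N_le1.
    rewrite /f; case: pickP => [z | /(_ y)]; rewrite Ny !inE ?eqxx //=.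
    by move/eqP->.
  exists f; split=> [x z xD zD fxz | x xD]; last by rewrite fN ?set11.
  apply/eqP/negPn/negP => xz.
  have := implyP (forallP hallN [set x; z]).
  rewrite subUset !sub1set xD zD cards2 xz => /(_ isT).
  by rewrite /nbhd bigcup_setU !big_set1 !fN // fxz setUid cards1.
have step y : y \in N x -> hall_condition (drop_edge N x y) D ->
  exists f : X -> Y, {in D &, injective f} /\ {in D, forall x, f x \in N x}.
  move=> yN hallN'; have [|f [f_inj fN]] := IHm (drop_edge N x y) _ hallN'.
    rewrite -ltnS (leq_trans _ ltm) // ltnS (bigD1 x) //= [ltnRHS](bigD1 x) //=.
    rewrite -addSn leq_add //.
      by rewrite /drop_edge eqxx [leqRHS](cardsD1 y) yN.
    by apply: leq_sum => z _; apply/subset_leq_card/sub_drop_edge.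
  exists f; split=> // z zD.
  by have := fN z zD; apply/subsetP/sub_drop_edge.
by case/orP: (hall_drop_edge N D x y1 y2 hallN y12) => /step; apply.
Qed.

End Hall.

(** * Matching even subsets with odd subsets *)

Section Parity.
Context {I : finType}.
Implicit Types (T U : {set I}) (F : {set {set I}}).

Definition toggle (j : I) T : {set I} := if j \in T then T :\ j else j |: T.

Lemma in_toggle j T i :
  (i \in toggle j T) = (if i == j then j \notin T else i \in T).
Proof.
rewrite /toggle; case: ifP => jT; rewrite !inE; case: (eqVneq i j) => [->|] //=.
Qed.

Lemma toggleK j : involutive (toggle j).
Proof.
by move=> T; apply/setP => i; rewrite !in_toggle eqxx negbK; case: eqP => [->|].
Qed.

Lemma odd_toggle j T : odd #|toggle j T| = ~~ odd #|T|.
Proof.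
rewrite /toggle; case: ifPn => jT; last by rewrite cardsU1 jT.
by rewrite [in RHS](cardsD1 j) jT /= negbK.
Qed.

Definition even_sets : {set {set I}} := [set T : {set I} | ~~ odd #|T|].
Definition odd_sets : {set {set I}} := [set T : {set I} | odd #|T|].

Lemma toggle_even j T : T \in even_sets -> toggle j T \in odd_sets.
Proof. by rewrite !inE odd_toggle. Qed.

Lemma card_even_odd_sets (j : I) : #|even_sets| = #|odd_sets|.
Proof.
rewrite -(card_imset _ (inv_inj (toggleK j))); congr #|pred_of_set _|.
apply/setP => U; rewrite -[U in LHS](toggleK j) mem_imset ?inE.
  by rewrite odd_toggle negbK.
exact/inv_inj/toggleK.
Qed.

(** The empty set is left free to be matched with any odd set, which makes the
    two sides equinumerous and the injection given by Hall's theorem onto. *)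
Lemma even_odd_matching (c : {set I} -> I) :
    (forall T : {set I}, T \in even_sets -> 0 < #|T| -> c T \in T) ->
  exists phi : {set I} -> {set I},
    [/\ {in even_sets &, injective phi}, phi @: even_sets = odd_sets
      & forall T : {set I}, T \in even_sets -> 0 < #|T| -> c T \in phi T].
Proof.
move=> c_mem.
pose j0 := c set0.
pose N T := [set U : {set I} in odd_sets | (0 < #|T|) ==> (c T \in U)].
have hallN : hall_condition N even_sets.
  apply/forallP => F; apply/implyP => /subsetP F_even.
  (* The injection witnessing Hall's condition for F is toggling one element. *)
  suff [j Nj] : exists j, {in F, forall T, toggle j T \in nbhd N F}.
    rewrite -(card_imset _ (inv_inj (toggleK j))).
    by apply/subset_leq_card/subsetP => _ /imsetP[T TF ->]; apply: Nj.
  have [F0 | F0] := boolP (set0 \in F).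
    exists j0 => T TF; apply/bigcupP; exists set0; rewrite // inE cards0.
    by rewrite toggle_even ?F_even.
  have F_gt0 T : T \in F -> 0 < #|T|.
    by move=> TF; rewrite card_gt0; apply: contraNneq F0 => <-.
  have [cF | ] := eqVneq (c @: F) setT.
    (* The toggled set is odd, so it contains some i, chosen in some V. *)
    exists j0 => T TF; have tT := toggle_even j0 T (F_even _ TF).
    have /card_gt0P[i it] : 0 < #|toggle j0 T|.
      by move: tT; rewrite inE; case: #|_|.
    have /imsetP[V VF ic] : i \in c @: F by rewrite cF inE.
    by apply/bigcupP; exists V; rewrite // inE tT -ic it implybT.
  (* Otherwise toggle some j that is never chosen: c T stays in the set. *)
  rewrite -subTset => /subsetPn[j _ jF]; exists j => T TF.
  apply/bigcupP; exists T; rewrite // inE toggle_even ?F_even //= in_toggle.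
  case: eqP => [cj | _]; first by rewrite -cj imset_f in jF.
  by rewrite c_mem ?implybT ?F_even ?F_gt0.
have [phi [phi_inj phiN]] := hall_marriage N even_sets set0 hallN.
exists phi; split=> // [|T TE T_gt0]; last first.
  by have := phiN T TE; rewrite inE T_gt0 => /andP[].
apply/eqP; rewrite eqEcard card_in_imset // (card_even_odd_sets j0) leqnn andbT.
apply/subsetP => _ /imsetP[T TE ->].
by have := phiN T TE; rewrite inE => /andP[].
Qed.

End Parity.

(** * Products of additively closed sets *)

Local Open Scope classical_set_scope.
Local Open Scope ring_scope.

Section IdealProducts.
Context {A : comRngType}.
Implicit Types (I J K : set A) (x y z : A).

Lemma rng_mulDr x : {morph rng_mul x : y z / y + z}.
Proof. by move=> y z; rewrite rng_mulC rng_mulDl !(rng_mulC x). Qed.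

Lemma rng_mulr0 x : rng_mul x 0 = 0.
Proof. by apply: (@addrI _ (rng_mul x 0)); rewrite -rng_mulDr !addr0. Qed.

(** The property that reduces the membership of a sum to that of its terms. *)
Definition add_closed I := I 0 /\ forall x y, I x -> I y -> I (x + y).

Lemma is_ideal_add_closed I : is_ideal I -> add_closed I.
Proof.
case=> I0 IB _; split=> // x y Ix Iy.
by rewrite -[y]opprK -[- y]sub0r; do 2!apply: (IB) => //.
Qed.

Lemma add_closed_sum (X : eqType) (s : seq X) (f : X -> A) J :
  add_closed J -> (forall p, p \in s -> J (f p)) -> J (\sum_(p <- s) f p).
Proof.
by case=> J0 JD Jf; rewrite big_seq; elim/big_ind: _ => // x y; apply: JD.
Qed.

(** Lets one factor of a product be replaced by the terms of a sum while the
    other factor [x] stays fixed. *)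
Lemma add_closed_transporter J x :
  add_closed J -> add_closed [set y | J (rng_mul x y)].
Proof.
case=> J0 JD; split=> [|y z] /=; first by rewrite rng_mulr0.
by rewrite rng_mulDr; apply: JD.
Qed.

Lemma mem_ideal_mul I J x y : I x -> J y -> ideal_mul I J (rng_mul x y).
Proof.
move=> Ix Jy; exists [:: (x, y)]; last by rewrite big_seq1.
by move=> p; rewrite inE => /eqP->.
Qed.

Lemma ideal_mul_add_closed I J : add_closed (ideal_mul I J).
Proof.
split=> [|_ _ [s sIJ ->] [t tIJ ->]]; first by exists [::]; rewrite ?big_nil.
exists (s ++ t); last by rewrite big_cat.
by move=> p; rewrite mem_cat => /orP[/sIJ | /tIJ].
Qed.

Lemma ideal_mul_sub I J K : add_closed K ->
    (forall x y, I x -> J y -> K (rng_mul x y)) ->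
  ideal_mul I J `<=` K.
Proof.
move=> Kadd IJK _ [s sIJ ->]; apply: add_closed_sum => // p /sIJ[].
exact: IJK.
Qed.

Lemma ideal_mulS I1 J1 I2 J2 :
  I1 `<=` I2 -> J1 `<=` J2 -> ideal_mul I1 J1 `<=` ideal_mul I2 J2.
Proof.
move=> sI sJ; apply: ideal_mul_sub => [|x y /sI Ix /sJ Jy].
  exact: ideal_mul_add_closed.
exact: mem_ideal_mul.
Qed.

Lemma ideal_mulC : commutative (@ideal_mul A).
Proof.
suff sub I J : ideal_mul I J `<=` ideal_mul J I by move=> I J; apply/seteqP.
apply: ideal_mul_sub => [|x y Ix Jy]; first exact: ideal_mul_add_closed.
by rewrite rng_mulC; apply: mem_ideal_mul.
Qed.

Lemma ideal_mulA : associative (@ideal_mul A).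
Proof.
have sub I J K : ideal_mul I (ideal_mul J K) `<=` ideal_mul (ideal_mul I J) K.
  have addM := ideal_mul_add_closed (ideal_mul I J) K.
  apply: ideal_mul_sub => // x y Ix; move: y.
  apply: ideal_mul_sub => [|y z Jy Kz]; first exact: add_closed_transporter.
  by rewrite /= rng_mulA; do 2!apply: mem_ideal_mul => //.
move=> I J K; apply/seteqP; split; first exact: sub.
rewrite ideal_mulC (ideal_mulC I J) (ideal_mulC I) (ideal_mulC J K).
exact: sub.
Qed.

(** Without a unity, [ideal_mul] may lack a neutral element; adjoining [None]
    gives a commutative monoid law, so that big operators apply. *)
Notation imul := (oAC ideal_mulA ideal_mulC).

Lemma some_ideal_prod (s : seq (set A)) : s <> [::] ->
  Some (ideal_prod s) = \big[imul/None]_(J <- s) Some J.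
Proof.
elim: s => // J [|K s] IHs _; first by rewrite big_seq1.
by rewrite big_cons -IHs.
Qed.

(** Inclusion, extended to the adjoined neutral element; the latter is
    comparable only to itself. *)
Definition osub (u v : option (set A)) : Prop :=
  match u, v with
  | Some U, Some V => U `<=` V
  | None, None => True
  | _, _ => False
  end.

Lemma osub_imul u1 v1 u2 v2 :
  osub u1 v1 -> osub u2 v2 -> osub (imul u1 u2) (imul v1 v2).
Proof.
by case: u1 v1 u2 v2 => [I1|] [J1|] [I2|] [J2|] //= s1 s2; apply: ideal_mulS.
Qed.

Lemma osub_big (X : Type) (r : seq X) (P : pred X) (F G : X -> set A) :
    (forall t, P t -> F t `<=` G t) ->
  osub (\big[imul/None]_(x <- r | P x) Some (F x))
       (\big[imul/None]_(x <- r | P x) Some (G x)).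
Proof. by move=> FG; apply: big_ind2 => //; exact: osub_imul. Qed.

Lemma big_add_closed (X : Type) (r : seq X) (P : pred X) (F : X -> set A) J :
    (forall t, add_closed (F t)) ->
    \big[imul/None]_(x <- r | P x) Some (F x) = Some J ->
  add_closed J.
Proof.
move=> Fadd; pose Q u := if u is Some V then add_closed V else True.
suff : Q (\big[imul/None]_(x <- r | P x) Some (F x)) by move=> + FJ; rewrite FJ.
apply: big_ind => [//|[I|] [K|] //= _ _|t _]; last exact: Fadd.
exact: ideal_mul_add_closed.
Qed.

(** * Sums of members of a family and distributivity *)

Section Family.
Context {n : nat} (a : 'I_n -> set A).
Implicit Types (T : {set 'I_n}).

Lemma ideal_sum_sub T J : add_closed J ->
  (forall i, i \in T -> a i `<=` J) -> ideal_sum a T `<=` J.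
Proof.
move=> Jadd aJ _ [f fa ->]; rewrite -big_enum /=.
apply: add_closed_sum => // i; rewrite mem_enum => iT.
by apply: aJ (fa i iT).
Qed.

Hypothesis a_add : forall i, add_closed (a i).

Lemma ideal_sum_add_closed T : add_closed (ideal_sum a T).
Proof.
split=> [|_ _ [f fa ->] [g ga ->]].
  by exists (fun=> 0); rewrite ?big1 // => i _; case: (a_add i).
exists (fun i => f i + g i); rewrite ?big_split // => i iT.
by case: (a_add i) => _; apply; [apply: fa | apply: ga].
Qed.

Lemma sub_ideal_sum T i : i \in T -> a i `<=` ideal_sum a T.
Proof.
move=> iT x ax; exists (fun j => if j == i then x else 0).
  by move=> j _; case: eqP => [-> | _] //; case: (a_add j).
by rewrite (bigD1 i) //= eqxx big1 ?addr0 // => j /andP[_ /negPf->].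
Qed.

Lemma imul_ideal_sum_sub T u J : add_closed J ->
    (forall i, i \in T -> osub (imul (Some (a i)) u) (Some J)) ->
  osub (imul (Some (ideal_sum a T)) u) (Some J).
Proof.
case: u => [K|] Jadd aKJ /=; last exact: ideal_sum_sub.
apply: ideal_mul_sub => // x y + Ky; rewrite rng_mulC; move: x.
apply: ideal_sum_sub => [|i iT x ax /=]; first exact: add_closed_transporter.
by rewrite rng_mulC; apply: (aKJ i iT); apply: mem_ideal_mul.
Qed.

(** Distributivity: a product of sums lies in [J] as soon as all the products
    obtained by choosing one term in each sum do.  The factor [u] accumulates
    the terms already chosen along the induction, and [i0] provides a value for
    choice functions outside [r]. *)
Lemma big_ideal_sum_sub (r : seq {set 'I_n}) u J (i0 : 'I_n) :
    uniq r -> add_closed J ->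
    (forall c : {set 'I_n} -> 'I_n, (forall T, T \in r -> c T \in T) ->
       osub (imul u (\big[imul/None]_(T <- r) Some (a (c T)))) (Some J)) ->
  osub (imul u (\big[imul/None]_(T <- r) Some (ideal_sum a T))) (Some J).
Proof.
move=> + Jadd; elim: r u => [|T r IHr] u /=.
  by move=> _ /(_ (fun=> i0)); rewrite !big_nil; apply.
case/andP=> Tr r_uniq cJ; rewrite big_cons Monoid.mulmCA /=.
apply: imul_ideal_sum_sub => // i iT; rewrite Monoid.mulmA /=.
apply: IHr => // c c_mem.
have := cJ [eta c with T |-> i]; rewrite big_cons /= eqxx.
rewrite Monoid.mulmCA Monoid.mulmA /= (eq_big_seq (fun U => Some (a (c U)))).
  apply=> U; rewrite inE; case: eqP => [-> | _] //=; exact: c_mem.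
by move=> U Ur /=; case: eqP => // UT; rewrite -UT Ur in Tr.
Qed.

(** Gathers the factors of all the [G(k)] with [P k] into one product over
    subsets, the form in which parity classes can be reindexed. *)
Lemma big_card (F : {set 'I_n} -> option (set A)) (P : pred nat) :
  \big[imul/None]_(k <- iota 1 n | P k)
      \big[imul/None]_(T : {set 'I_n} | #|T| == k) F T
    = \big[imul/None]_(T : {set 'I_n} | (0 < #|T|)%N && P #|T|) F T.
Proof.
rewrite (_ : iota 1 n = index_iota 1 n.+1); last by rewrite /index_iota subn1.
rewrite big_nat_cond.
rewrite (exchange_big_dep (fun T : {set 'I_n} => (0 < #|T|)%N && P #|T|)) /=.
  apply: eq_bigr => T /andP[T_gt0 PT].
  rewrite (eq_bigl (fun k => ((0 < k < n.+1)%N && P k) && (k == #|T|))).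
    rewrite (big_nat1_cond_eq _ _ (fun k => (0 < k < n.+1)%N && P k)) T_gt0 PT.
    by rewrite !ltnS -[X in (_ <= X)%N]card_ord max_card.
  by move=> k; rewrite [_ == k]eq_sym.
by move=> k T /andP[/andP[k_gt0 _] Pk] /eqP->; rewrite k_gt0.
Qed.

(** The bound on [k] matters: for an empty list, [ideal_prod] is the whole ring
    while the big operator is the adjoined neutral element. *)
Lemma some_prod_draws (F : {set 'I_n} -> set A) k : (k <= n)%N ->
  Some (ideal_prod [seq F T | T : {set 'I_n} <- enum {set 'I_n} & #|T| == k])
    = \big[imul/None]_(T : {set 'I_n} | #|T| == k) Some (F T).
Proof.
move=> le_kn; rewrite some_ideal_prod.
  by rewrite big_map big_filter big_enum_cond.
have : (0 < #|[set T : {set 'I_n} | #|T| == k]%SET|)%N.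
  by rewrite card_draws card_ord bin_gt0.
case/card_gt0P => T; rewrite inE => Tk; apply/eqP.
rewrite -size_eq0 size_map size_filter -lt0n -has_count.
by apply/hasP; exists T; rewrite ?mem_enum.
Qed.

Lemma idealL_full : idealL a n = ideal_cap a setT.
Proof.
apply: Some_inj; rewrite some_prod_draws // (big_pred1 setT) // => T /=.
have := max_card T; rewrite card_ord [RHS]eqEcard subsetT cardsT card_ord /=.
by rewrite eqn_leq => ->.
Qed.

Lemma big_some_idealG (P : pred nat) :
  \big[imul/None]_(J <- [seq idealG a k | k <- iota 1 n & P k]) Some J
    = \big[imul/None]_(T : {set 'I_n} | (0 < #|T|)%N && P #|T|)
        Some (ideal_sum a T).
Proof.
rewrite big_map big_filter -big_card big_seq_cond [RHS]big_seq_cond.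
apply: eq_bigr => k; rewrite mem_iota add1n ltnS => /andP[/andP[_ le_kn] _].
exact: some_prod_draws.
Qed.

End Family.
End IdealProducts.

Theorem theorem5p1 (A : comRngType) (n : nat) (a : 'I_n -> set A)
    (n_ge1 : (1 <= n)%N) (n_le6 : (n <= 6)%N)
    (a_ideal : forall i, is_ideal (a i)) :
  ideal_prod (idealL a n :: [seq idealG a k | k <- iota 1 n & ~~ odd k])
  `<=` ideal_prod [seq idealG a k | k <- iota 1 n & odd k].
Proof.
have a_add i := is_ideal_add_closed _ (a_ideal i).
pose mul := oAC (@ideal_mulA A) (@ideal_mulC A).
have defR : Some (ideal_prod [seq idealG a k | k <- iota 1 n & odd k])
    = \big[mul/None]_(T in odd_sets) Some (ideal_sum a T).
  rewrite some_ideal_prod ?big_some_idealG.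
    by apply: eq_bigl => T; rewrite inE; case: #|T|.
  by case: (n) n_ge1 (idealG a).
suff : osub (Some (ideal_prod (idealL a n
           :: [seq idealG a k | k <- iota 1 n & ~~ odd k])))
         (Some (ideal_prod [seq idealG a k | k <- iota 1 n & odd k])) by [].
rewrite some_ideal_prod // big_cons big_some_idealG idealL_full.
(* The distributivity lemma takes an explicit list of distinct subsets. *)
rewrite -big_filter.
apply: (big_ideal_sum_sub _ _ _ _ (Ordinal n_ge1)).
- by rewrite filter_uniq // index_enum_uniq.
- by apply: big_add_closed _ (esym defR); apply: ideal_sum_add_closed.
move=> c c_mem.
have [T0 | phi [phi_inj phi_odd phiP]] := even_odd_matching c.
  rewrite inE => TE T_gt0; apply: c_mem.
  by rewrite mem_filter T_gt0 TE mem_index_enum.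
(* Reindex the odd side by phi; its factor at set0 will receive L(n). *)
rewrite defR -phi_odd big_imset //= (bigD1 set0) /= ?inE ?cards0 //.
have -> : \big[mul/None]_(T in even_sets | T != set0) Some (ideal_sum a (phi T))
  = \big[mul/None]_(T : {set 'I_n} | (0 < #|T|)%N && ~~ odd #|T|)
        Some (ideal_sum a (phi T)).
  by apply: eq_bigl => T; rewrite inE card_gt0 andbC.
rewrite big_filter; apply: osub_imul => /=.
  have : phi set0 \in odd_sets by rewrite -phi_odd imset_f // inE cards0.
  rewrite inE => phi_odd0.
  have /card_gt0P[i iphi] : (0 < #|phi set0|)%N by case: #|_| phi_odd0.
  by move=> x xL; apply: (sub_ideal_sum _ a_add _ i) => //; apply: xL.
apply: osub_big => T /andP[T_gt0 TE]; apply: sub_ideal_sum => //.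
by apply: phiP; rewrite ?inE.
Qed.
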